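(* The set of $f$-vectors of simplicial complexes is contained in the set of $h$-vectors (up to trailing zeros) of balanced vertex decomposable simplicial complexes.
   Context: All simplicial complexes are finite and contain the empty face. A simplicial complex $\Delta$ on a finite vertex set $V$ is a collection of subsets (faces) of $V$ closed under taking subsets; facets are the inclusion-maximal faces. A face $\sigma$ has dimension $|\sigma|-1$; $\dim\Delta$ is the maximum dimension of a facet; $\Delta$ is pure if all facets have the same dimension; a simplex is a complex with exactly one facet (including $\{\emptyset\}$). If $\dim\Delta=d$, then $f(\Delta)=(f_{-1},f_0,\dots,f_d)$ with $f_i$ the number of faces of dimension $i$, and $h(\Delta)=(h_0,\dots,h_{d+1})$ with $h_k=\sum_{i=0}^k(-1)^{k-i}\binom{d+1-i}{k-i}f_{i-1}$. Trailing zeros of $h$-vectors are ignored when comparing with $f$-vectors. An $s$-colouring of $\Delta$ is a partition $V=V_1\cup\dots\cup V_s$ into pairwise disjoint, possibly empty sets with $|F\cap V_j|\le1$ for every facet $F$ and every $j$. A complex of dimension $d-1$ is balanced if it has a $d$-colouring. For a vertex $v$ with $\{v\}\in\Delta$: $\Delta\setminus v=\{\tau\in\Delta : v\notin\tau\}$ and ${\rm link}_\Delta(v)=\{\tau\in\Delta : v\notin\tau,\ \tau\cup\{v\}\in\Delta\}$. A pure complex is vertex decomposable if it is a simplex, or it has a vertex $v$ such that $\Delta\setminus v$ and ${\rm link}_\Delta(v)$ are both (pure and) vertex decomposable. *)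

(* Defs.v *)
From mathcomp Require Import all_boot all_order all_algebra.

Set Implicit Arguments.
Unset Strict Implicit.
Unset Printing Implicit Defensive.

Import Order.TTheory GRing.Theory Num.Theory.
Local Open Scope ring_scope.

(* A complex on the vertex set V (a finType) is a family of subsets of V.     *)
(* Vertices v with [set v] \notin D are allowed.                              *)
Definition simplicial_complex (V : finType) (D : {set {set V}}) : Prop :=
  set0 \in D /\
  (forall F G : {set V}, F \in D -> G \subset F -> G \in D).

Definition facets (V : finType) (D : {set {set V}}) : {set {set V}} :=
  [set F | maxset (fun G => G \in D) F].

(* Faces are graded by cardinality, i.e. by dimension + 1, so that all        *)
(* indices are natural numbers: cdim1 D is dim D + 1 and fnum D i is f_(i-1). *)
Definition cdim1 (V : finType) (D : {set {set V}}) : nat :=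
  (\max_(F in facets D) #|F|)%N.

Definition fnum (V : finType) (D : {set {set V}}) (i : nat) : nat :=
  #|[set F in D | #|F| == i]|.

Definition pure (V : finType) (D : {set {set V}}) : Prop :=
  forall F G : {set V}, F \in facets D -> G \in facets D -> #|F| = #|G|.

Definition is_simplex (V : finType) (D : {set {set V}}) : Prop :=
  #|facets D| = 1%N.

(* Meaningful for k <= dim D + 1; no subtraction is then truncated. *)
Definition hnum (V : finType) (D : {set {set V}}) (k : nat) : int :=
  \sum_(i < k.+1)
    (-1) ^+ (k - i) * ('C(cdim1 D - i, k - i))%:Z * (fnum D i)%:Z.

Definition fvector (V : finType) (D : {set {set V}}) : seq int :=
  mkseq (fun i => (fnum D i)%:Z) (cdim1 D).+1.

Definition hvector (V : finType) (D : {set {set V}}) : seq int :=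
  mkseq (hnum D) (cdim1 D).+1.

(* s`_k is 0 beyond the end of s. *)
Definition eq_upto_trailing_zeros (s t : seq int) : Prop :=
  forall k : nat, s`_k = t`_k.

Definition is_colouring (V : finType) (D : {set {set V}}) (s : nat)
    (C : 'I_s -> {set V}) : Prop :=
  [/\ \bigcup_(j < s) C j = [set: V],
      forall i j : 'I_s, i != j -> [disjoint C i & C j]
    & forall (F : {set V}) (j : 'I_s),
        F \in facets D -> (#|F :&: C j| <= 1)%N].

Definition balanced (V : finType) (D : {set {set V}}) : Prop :=
  exists C : 'I_(cdim1 D) -> {set V}, is_colouring D C.

Definition deletion (V : finType) (D : {set {set V}}) (v : V) : {set {set V}} :=
  [set F in D | v \notin F].

Definition link (V : finType) (D : {set {set V}}) (v : V) : {set {set V}} :=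
  [set F in D | (v \notin F) && (v |: F \in D)].

Inductive vertex_decomposable (V : finType) : {set {set V}} -> Prop :=
| vd_simplex (D : {set {set V}}) :
    pure D -> is_simplex D -> vertex_decomposable D
| vd_shed (D : {set {set V}}) (v : V) :
    pure D -> [set v] \in D ->
    vertex_decomposable (deletion D v) ->
    vertex_decomposable (link D v) ->
    vertex_decomposable D.

(* Main.v *)
Require Import Defs.
From mathcomp Require Import all_boot all_order all_algebra.

(** Attach to every vertex [v] of [D] a new vertex [v'], and let [G] consist of
    the sets [s :|: t'] with [s] in [D] and [t] disjoint from [s]. Giving [v]
    and [v'] the same colour shows that [G] is balanced of dimension [#|V| - 1].
    The deletion and the link of an old vertex [v] arise in the same way from
    those of [D] (with [v'] discarded for the link), so [G] is vertex
    decomposable by induction. Finally a face [s] of [D] contributes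
    [t^|s| (1 + t)^(n - |s|)] to the f-polynomial of [G], hence [t^|s|] to its
    h-polynomial. *)

Set Implicit Arguments.
Unset Strict Implicit.
Unset Printing Implicit Defensive.

Import Order.TTheory GRing.Theory Num.Theory.
Local Open Scope ring_scope.

(** * Facets, f-vectors, deletions and links *)

Lemma sub_facet (W : finType) (G : {set {set W}}) (F : {set W}) :
  F \in G -> exists2 H, H \in facets G & F \subset H.
Proof.
move=> FG; have [H mH sFH] := maxset_exists (P := fun A => A \in G) FG.
by exists H => //; rewrite inE.
Qed.

Lemma facet_face (W : finType) (G : {set {set W}}) (F : {set W}) :
  F \in facets G -> F \in G.
Proof. by rewrite inE => /maxsetp. Qed.

Lemma leq_card_cdim1 (W : finType) (G : {set {set W}}) (F : {set W}) :
  F \in G -> (#|F| <= cdim1 G)%N.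
Proof.
move=> /sub_facet[H HG /subset_leq_card/leq_trans]; apply.
exact: (leq_bigmax_cond (F := fun A : {set W} => #|A|)).
Qed.

Lemma nth_fvector (W : finType) (G : {set {set W}}) (k : nat) :
  (fvector G)`_k = (fnum G k)%:Z.
Proof.
rewrite /fvector; case: (ltnP k (cdim1 G).+1) => hk; first by rewrite nth_mkseq.
(* Past the end of the list the entry defaults to 0, and no face has more than [cdim1 G]
   elements. *)
rewrite nth_default ?size_mkseq // /fnum; apply/esym/eqP.
rewrite eqz_nat cards_eq0; apply/eqP/setP => F; rewrite !inE.
apply/negP => /andP[/leq_card_cdim1 + /eqP Fk].
by rewrite Fk leqNgt hk.
Qed.

Lemma deletion_complex (V : finType) (D : {set {set V}}) (v : V) :
  simplicial_complex D -> simplicial_complex (deletion D v).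
Proof.
case=> D0 Dd; split=> [|F G]; first by rewrite !inE D0.
rewrite !inE => /andP[FD vF] sGF; rewrite (Dd _ _ FD sGF) /=.
by apply: contra vF; apply: (subsetP sGF).
Qed.

Lemma link_complex (V : finType) (D : {set {set V}}) (v : V) :
  simplicial_complex D -> [set v] \in D -> simplicial_complex (link D v).
Proof.
case=> D0 Dd vD; split=> [|F G]; first by rewrite !inE D0 setU0 vD.
rewrite !inE => /and3P[FD vF vFD] sGF; rewrite (Dd _ _ FD sGF) /=.
rewrite (Dd _ _ vFD (setUS _ sGF)) andbT.
by apply: contra vF; apply: (subsetP sGF).
Qed.

(** * The complex with a new vertex for each old one *)

Section Whisker.

Variable V : finType.
Implicit Types (D : {set {set V}}) (S s t : {set V}) (F : {set V + V}).

(** [inl v] stands for the old vertex [v] and [inr v] for its new twin [v']. *)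
Definition old_part F : {set V} := [set v | inl v \in F].
Definition new_part F : {set V} := [set v | inr v \in F].

Definition glue s t : {set V + V} :=
  [set x | match x with inl v => v \in s | inr v => v \in t end].

Lemma old_part_glue s t : old_part (glue s t) = s.
Proof. by apply/setP=> v; rewrite !inE. Qed.

Lemma new_part_glue s t : new_part (glue s t) = t.
Proof. by apply/setP=> v; rewrite !inE. Qed.

Lemma glue_parts F : glue (old_part F) (new_part F) = F.
Proof. by apply/setP=> -[] v; rewrite !inE. Qed.

Lemma card_parts F : #|F| = (#|old_part F| + #|new_part F|)%N.
Proof.
rewrite -!sum1_card big_sumType /=.
by congr (_ + _)%N; apply: eq_bigl => v; rewrite inE.
Qed.

(* [S] carries the new vertices; it must shrink when passing to links. *)
Definition whisker D S : {set {set V + V}} :=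
  [set F | [&& old_part F \in D, new_part F \subset S
             & [disjoint old_part F & new_part F]]].

Lemma whisker_complex D S :
  simplicial_complex D -> simplicial_complex (whisker D S).
Proof.
case=> D0 Dd.
have part0 : (old_part set0 = set0) * (new_part set0 = set0).
  by split; apply/setP=> v; rewrite !inE.
split; first by rewrite inE !part0 D0 sub0set -setI_eq0 set0I eqxx.
move=> F G; rewrite !inE => /and3P[FD FS dF] sGF.
have sO : old_part G \subset old_part F.
  by apply/subsetP=> v; rewrite !inE; apply: (subsetP sGF).
have sN : new_part G \subset new_part F.
  by apply/subsetP=> v; rewrite !inE; apply: (subsetP sGF).
rewrite (Dd _ _ FD sO) (subset_trans sN FS) /=.
exact: disjointWl sO (disjointWr sN dF).
Qed.

(** Adding to a face every twin from [S] of a vertex outside its old part gives a face again, so a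
    maximal face already contains all of them. *)
Lemma whisker_facetE D S F :
  F \in facets (whisker D S) -> F = glue (old_part F) (S :\: old_part F).
Proof.
rewrite inE => /maxsetP[]; rewrite inE => /and3P[FD FS dF] maxF.
apply/esym/maxF.
  rewrite inE old_part_glue new_part_glue FD subsetDl /=.
  by rewrite -setI_eq0 setIDA setIC setDIl setDv setI0.
rewrite -{1}(glue_parts F); apply/subsetP=> -[] v; rewrite !inE // => vF.
rewrite (subsetP FS) ?inE // andbT; apply/negP => vO.
by move/pred0P/(_ v): dF; rewrite /= !inE vF vO.
Qed.

(** The old part [s] lies in [S], so [s] and the twins of [S :\: s] together number [#|S|]. *)
Lemma card_whisker_facet D S F :
  (forall s, s \in D -> s \subset S) ->
  F \in facets (whisker D S) -> #|F| = #|S|.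
Proof.
move=> DS fF; have := facet_face fF; rewrite inE => /and3P[FD _ _].
rewrite (whisker_facetE fF) card_parts old_part_glue new_part_glue.
by rewrite -[in RHS](cardsID (old_part F) S) (setIidPr (DS _ FD)).
Qed.

Lemma pure_whisker D S :
  (forall s, s \in D -> s \subset S) -> pure (whisker D S).
Proof.
by move=> DS F G fF fG; rewrite (card_whisker_facet DS fF) (card_whisker_facet DS fG).
Qed.

Lemma cdim1_whisker D S :
  simplicial_complex D -> (forall s, s \in D -> s \subset S) ->
  cdim1 (whisker D S) = #|S|.
Proof.
move=> cD DS; apply/eqP; rewrite eqn_leq; apply/andP; split.
  by apply/bigmax_leqP => F /(card_whisker_facet DS) ->.
have [F fF _] := sub_facet (whisker_complex S cD).1.
by rewrite -(card_whisker_facet DS fF) leq_card_cdim1 // facet_face.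
Qed.

(** * Vertex decomposability and colouring *)

Lemma deletion_whisker D S v :
  deletion (whisker D S) (inl v) = whisker (deletion D v) S.
Proof.
apply/setP=> F; rewrite !inE.
by case: (_ \in D); case: (inl v \in F); rewrite ?andbF ?andbT.
Qed.

Lemma link_whisker D S v :
  link (whisker D S) (inl v) = whisker (link D v) (S :\ v).
Proof.
apply/setP=> F; rewrite !inE.
have -> : old_part (inl v |: F) = v |: old_part F.
  by apply/setP=> w; rewrite !inE.
have -> : new_part (inl v |: F) = new_part F.
  by apply/setP=> w; rewrite !inE.
(* Disjointness from [v |: old_part F] also forbids the twin of [v], which is what shrinks [S] to
   [S :\ v]. *)
rewrite [[disjoint v |: _ & _]]disjoints_subset subUset sub1set -disjoints_subset
  subsetD1 !inE.
case: (old_part F \in D) => //=; case: (new_part F \subset S); rewrite /= ?andbF //.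
by case: [disjoint _ & _]; case: (inl v \in F); case: (_ \in D);
   case: (inr v \in F).
Qed.

(** Induction on the number of faces of [D]: deletion and link of [v] both lose the face [[set v]].
    Faces of the link avoid [v], so they stay inside [S :\ v]. *)
Lemma vd_whisker D S :
  simplicial_complex D -> (forall s, s \in D -> s \subset S) ->
  vertex_decomposable (whisker D S).
Proof.
have [n] := ubnP #|D|; elim: n D S => // n IHn D S.
rewrite ltnS => leDn cD DS; have [D0 Dd] := cD.
have [v vD | noV] := pickP (fun v => [set v] \in D).
  have smaller D' : D' \subset D -> [set v] \notin D' -> (#|D'| < n)%N.
    move=> sD' vD'; apply: leq_trans leDn; apply: proper_card.
    by apply/properP; split=> //; exists [set v].
  apply: (@vd_shed _ _ (inl v)).
  - exact: pure_whisker.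
  - rewrite inE.
    have -> : old_part [set inl v] = [set v] by apply/setP=> w; rewrite !inE.
    have -> : new_part [set inl v] = set0 by apply/setP=> w; rewrite !inE.
    by rewrite vD sub0set -setI_eq0 setI0 eqxx.
  - rewrite deletion_whisker; apply: IHn.
    + apply: smaller; last by rewrite !inE eqxx andbF.
      by apply/subsetP=> s; rewrite inE => /andP[].
    + exact: deletion_complex.
    + by move=> s; rewrite inE => /andP[/DS].
  - rewrite link_whisker; apply: IHn.
    + apply: smaller; last by rewrite !inE eqxx andbF.
      by apply/subsetP=> s; rewrite inE => /andP[].
    + exact: link_complex.
    + by move=> s; rewrite inE subsetD1 => /and3P[/DS -> ->].
(* Without vertices [D] has only the empty face, and the complex is the full simplex on the twins of
   [S]. *)
have D_eq0 s : s \in D -> s = set0.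
  move=> sD; apply/eqP; apply: contraT => /set0Pn[v vs].
  by rewrite -(noV v) (Dd _ _ sD) // sub1set.
apply: vd_simplex; first exact: pure_whisker.
have facetE F : F \in facets (whisker D S) -> F = glue set0 S.
  move=> fF; have := facet_face fF; rewrite inE => /and3P[/D_eq0 F0 _ _].
  by rewrite (whisker_facetE fF) F0 setD0.
have [F fF _] := sub_facet (whisker_complex S cD).1.
apply/eqP/cards1P; exists (glue set0 S); apply/setP=> F'; rewrite in_set1.
by apply/idP/eqP => [/facetE | ->]; rewrite // -(facetE _ fF).
Qed.

Lemma balanced_whisker D :
  simplicial_complex D -> balanced (whisker D [set: V]).
Proof.
move=> cD; rewrite /balanced cdim1_whisker //.
pose base (x : V + V) := match x with inl v => v | inr v => v end.
rewrite cardsT.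
exists (fun j : 'I_#|V| => [set x | base x == enum_val j]); split.
- apply/setP=> x; rewrite inE; apply/bigcupP.
  by exists (enum_rank (base x)); rewrite ?inE ?enum_rankK.
- move=> i j; apply: contraR => /pred0Pn[x] /=; rewrite !inE => /andP[/eqP-> /eqP].
  by move/enum_val_inj->.
move=> F j /facet_face; rewrite inE => /and3P[_ _ dF].
have excl v : inl v \in F -> inr v \in F -> False.
  by move=> lF rF; move/pred0P/(_ v): dF; rewrite /= !inE lF rF.
(* Two elements of one colour are copies of the same vertex; they coincide unless one is old and the
   other new, which [excl] rules out. *)
apply/card_le1_eqP => -[] v [] w; rewrite !inE /= => /andP[vF /eqP ev] /andP[wF /eqP ew];
  move: vF wF; rewrite ev ew // => vF wF; by case: (excl _ vF wF) || case: (excl _ wF vF).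
Qed.

(** Faces are grouped by their old part [s]; the new part is then any set of [i - #|s|] elements
    outside [s]. The test [#|s| <= i] is essential: truncated subtraction would otherwise give
    ['C(_, 0) = 1]. *)
Lemma fnum_whisker D i :
  fnum (whisker D [set: V]) i =
  (\sum_(s in D) if #|s| <= i then 'C(#|V| - #|s|, i - #|s|) else 0)%N.
Proof.
rewrite /fnum -sum1_card.
rewrite (partition_big old_part (fun s => s \in D)) /=; last first.
  by move=> F; rewrite !inE => /andP[/and3P[]].
apply: eq_bigr => s sD; rewrite sum1_card.
rewrite (_ : #|_| = #|[set glue s t | t in [set t : {set V} |
                               (t \subset ~: s) && (#|s| + #|t| == i)%N]]|); last first.
  apply: eq_card => F; rewrite unfold_in !inE; apply/idP/imsetP.
    case/andP=> /andP[/and3P[_ _ dF] ci] /eqP Fs; exists (new_part F).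
      by rewrite inE -Fs -card_parts ci andbT -disjoints_subset disjoint_sym.
    by rewrite -Fs glue_parts.
  case=> t; rewrite inE -disjoints_subset disjoint_sym => /andP[dt ct] ->.
  by rewrite card_parts old_part_glue new_part_glue sD subsetT dt ct eqxx.
rewrite card_imset; last first.
  by move=> t u /(congr1 new_part); rewrite !new_part_glue.
have -> : (#|V| - #|s|)%N = #|~: s| by rewrite [RHS]cardsCs setCK.
case: leqP => si.
  rewrite -cards_draws; apply: eq_card => t; rewrite !inE.
  by rewrite -{1}(subnKC si) eqn_add2l.
apply/eqP; rewrite cards_eq0; apply/eqP/setP=> t; rewrite !inE.
apply/negP => /andP[_ /eqP e]; move: si.
by rewrite -e ltnNge leq_addr.
Qed.

End Whisker.

(** * Binomial identities and the h-vector *)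

(** Both sides count pairs of nested subsets, of sizes [a] and [k], of an [m]-set; multiplied by
    [pos]'s factorials, both become [m!]. *)
Lemma mul_bin_sub (m a k : nat) :
  (a <= k)%N -> (k <= m)%N ->
  ('C(m - a, k - a) * 'C(m, a) = 'C(m, k) * 'C(k, a))%N.
Proof.
move=> ak km; have am := leq_trans ak km.
have pos : (0 < a`! * (k - a)`! * (m - k)`!)%N by rewrite !muln_gt0 !fact_gt0.
apply/eqP; rewrite -(eqn_pmul2r pos); apply/eqP.
have e1 := bin_fact am; have e3 := bin_fact km; have e4 := bin_fact ak.
have := bin_fact (leq_sub2r a km); rewrite subnBA // subnK // => e2.
transitivity (m`!).
  by rewrite -e1 -e2 !mulnA [LHS](ACl (2*3*1*4*5)).
by rewrite -e3 -e4 !mulnA.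
Qed.

(* The coefficient of [t^k] in [(1 - t)^n] times [u^j (1 + u)^(n - j)] at
   [u = t / (1 - t)]. *)
Lemma alternating_bin_sum (n j k : nat) :
  (j <= n)%N -> (k <= n)%N ->
  \sum_(i < k.+1) (-1) ^+ (k - i) * ('C(n - i, k - i))%:Z *
    (if (j <= i)%N then 'C(n - j, i - j) else 0%N)%:Z = (j == k)%:Z.
Proof.
move=> jn kn; have [kj | jk] := ltnP k j.
  rewrite big1 ?(gtn_eqF kj) // => i _.
  by rewrite leqNgt (leq_trans (ltn_ord i) kj) mulr0.
rewrite -(big_mkord xpredT (fun i => (-1) ^+ (k - i) * ('C(n - i, k - i))%:Z *
    (if (j <= i)%N then 'C(n - j, i - j) else 0%N)%:Z)).
rewrite (@big_cat_nat _ _ _ j) //= ?leqW //.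
rewrite big_nat_cond big1 ?add0r; last first.
  by move=> i /andP[/andP[_ ij] _]; rewrite leqNgt ij mulr0.
(* The terms with [i < j] have vanished; the index is shifted by [j]. *)
rewrite -{1}[j]add0n big_addn subSn // big_mkord.
(* [mul_bin_sub] with [m = n - j] pulls out a factor free of [i], leaving the binomial expansion of
   a power of 0. *)
transitivity (('C(n - j, k - j))%:Z * (-1 + 1 : int) ^+ (k - j)).
  rewrite exprDn mulr_sumr; apply: eq_bigr => i _.
  have ik : (i <= k - j)%N by rewrite -ltnS.
  rewrite leq_addl addnK expr1n mulr1 (addnC i j) !subnDA -mulrA -PoszM.
  by rewrite mul_bin_sub ?leq_sub2r // PoszM mulrCA -mulr_natr natz.
rewrite addNr expr0n subn_eq0 eqn_leq jk /=.
by case: leqP => [kj|_]; rewrite ?mulr0 // mulr1 (eqP (kj : k - j == 0)%N) bin0.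
Qed.

Lemma hnum_whisker (V : finType) (D : {set {set V}}) (k : nat) :
  simplicial_complex D -> (k <= #|V|)%N ->
  hnum (whisker D [set: V]) k = (fnum D k)%:Z.
Proof.
move=> cD kV; rewrite /hnum cdim1_whisker // cardsT.
under eq_bigr => i _ do
  rewrite fnum_whisker (big_morph Posz PoszD (erefl _)) mulr_sumr.
(* With the sum over faces outermost, each face [s] contributes 1 if [#|s| = k] and 0 otherwise. *)
rewrite exchange_big /=.
under eq_bigr => s _ do rewrite alternating_bin_sum ?max_card //.
rewrite -(big_morph Posz PoszD (erefl _)) /fnum -sum1_card -big_mkcondr.
by congr Posz; apply: eq_bigl => s; rewrite inE.
Qed.

Theorem theorem4p2 (V : finType) (D : {set {set V}})
    (hD : simplicial_complex D) :
  exists (W : finType) (G : {set {set W}}),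
    [/\ simplicial_complex G, balanced G, vertex_decomposable G
      & eq_upto_trailing_zeros (hvector G) (fvector D)].
Proof.
exists (V + V)%type, (whisker D [set: V]); split.
- exact: whisker_complex.
- exact: balanced_whisker.
- exact: vd_whisker.
move=> k; rewrite nth_fvector /hvector cdim1_whisker // cardsT; case: (leqP k #|V|) => kV.
  by rewrite nth_mkseq // hnum_whisker.
(* For [k > #|V|] the h-vector entry is the default 0, and no subset of [V] has [k] elements. *)
rewrite nth_default ?size_mkseq //; apply/esym/eqP.
rewrite eqz_nat cards_eq0; apply/eqP/setP => s; rewrite !inE.
by rewrite ltn_eqF ?andbF // (leq_ltn_trans (max_card _) kV).
Qed.
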